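(* Let $W$ be a finite Coxeter group of rank $n$ with Coxeter generators $s_1,\dots,s_n$, and let $\mathsf k$ be a field of characteristic $0$. For every irreducible representation $V$ of $W$ over $\mathsf k$ and every $I\subset[n]=\{1,\dots,n\}$: (1) the small $W$-Kostka number $\kappa_{V,I}$ is a non-negative integer; (2) $\kappa_{V,I}=\kappa_{V^t,\overline I}$, where $\overline I=[n]\setminus I$ and $V^t=V\otimes\mathsf k_\epsilon$.
   Context: For $I\subset[n]$ let $W_I\subset W$ be the parabolic subgroup generated by $s_i$, $i\in I$, and let $M_I:=\mathsf k[W]\left(\sum_{w\in W_{\overline I}}w\right)\cong\mathrm{Ind}_{W_{\overline I}}^W\mathsf k$ (a left submodule of $\mathsf k[W]$, $\overline I=[n]\setminus I$). The $W$-Kostka number is $K_{V,I}:=\dim\mathrm{Hom}_{\mathsf k[W]}(M_I,V)$, and the small $W$-Kostka number is $$\kappa_{V,I}:=\sum_{J\subset I}(-1)^{|J|-|I|}K_{V,J}.$$ $\mathsf k_\epsilon$ is the sign representation: the one-dimensional representation on which each $s_i$ acts by $-1$. *)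

(* Defs.v *)
From HB Require Import structures.
From mathcomp Require Import all_boot all_order all_algebra all_fingroup all_solvable.
From mathcomp Require Import mxrepresentation character.

Set Implicit Arguments.
Unset Strict Implicit.
Unset Printing Implicit Defensive.

Import GRing.Theory.
Local Open Scope ring_scope.

(* (W, (s_i)) is a Coxeter system in the sense of Bourbaki: the s_i are distinct
   involutions generating W, and the relations (s_i s_j)^m_ij = 1, where m_ij is
   the order of s_i s_j (in particular m_ii = 1), present W. The last clause is
   the universal property of this presentation; it quantifies over all groups,
   finite or not. *)
Definition coxeter_system (gT : finGroupType) (W : {group gT}) (n : nat)
    (s : 'I_n -> gT) : Prop :=
  [/\ injective s,
      forall i, #[s i]%g = 2%N,
      <<[set s i | i : 'I_n]>>%g = W :> {set gT}
    & forall (hT : groupType) (f : 'I_n -> hT),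
        (forall i j, ((f i * f j) ^+ #[s i * s j] = 1)%g) ->
        exists phi : gT -> hT,
          {in W &, {morph phi : x y / (x * y)%g}} /\ forall i, phi (s i) = f i].

Definition parabolic (gT : finGroupType) (n : nat) (s : 'I_n -> gT)
    (I : {set 'I_n}) : {group gT} :=
  <<[set s i | i in I]>>%G.

(* An mx_representation acts on row vectors from the right. Throughout, it stands
   for the left module in which g acts by v |-> v *m rG g^-1; this identifies
   left and right modules without changing submodules or homomorphisms. *)

(* The space of homomorphisms from rG1 to rG2, as a space of mxvec-encoded
   matrices: see homs_mxP. *)
Definition homs_mx (F : fieldType) (gT : finGroupType) (G : {group gT})
    (n1 n2 : nat) (rG1 : mx_representation F G n1)
    (rG2 : mx_representation F G n2) : 'M[F]_(n1 * n2) :=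
  (\bigcap_(g in G) kermx (lin_mulmx (rG1 g) - lin_mulmxr (rG2 g)))%MS.

Definition dim_hom (F : fieldType) (gT : finGroupType) (G : {group gT})
    (n1 n2 : nat) (rG1 : mx_representation F G n1)
    (rG2 : mx_representation F G n2) : nat :=
  \rank (homs_mx rG1 rG2).

Lemma homs_mxP (F : fieldType) (gT : finGroupType) (G : {group gT})
    (n1 n2 : nat) (rG1 : mx_representation F G n1)
    (rG2 : mx_representation F G n2) (B : 'M[F]_(n1, n2)) :
  reflect {in G, forall g, rG1 g *m B = B *m rG2 g}
          (mxvec B <= homs_mx rG1 rG2)%MS.
Proof.
apply: (iffP sub_bigcapmxP) => [homB g Gg | homB g Gg].
  move/sub_kermxP: (homB g Gg); rewrite mulmxBr !mul_vec_lin -linearB /=.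
  by move/(canRL mxvecK)/eqP; rewrite linear0 subr_eq0 => /eqP.
apply/sub_kermxP; rewrite mulmxBr !mul_vec_lin /= /mulmxr homB //.
by rewrite subrr.
Qed.

Section GroupAlgebra.

Variables (F : fieldType) (gT : finGroupType) (G : {group gT}).

(* k[G] is 'rV_#|G|, with basis the elements of G in the order of enum G. The
   row of index x of left_regular_mx g is g^-1 x, so that, under the convention
   above, this is k[G] as a left module over itself. *)
Definition left_regular_mx (g : gT) : 'M[F]_#|G| :=
  \matrix_i delta_mx 0 (gring_index G (g^-1 * enum_val i)).

Lemma left_regular_mx_repr : mx_repr G left_regular_mx.
Proof.
split=> [|g h Gg Gh]; apply/row_matrixP=> i; rewrite !rowK.
  by rewrite invg1 mul1g row1 gring_valK.
by rewrite row_mul rowK -rowE rowK gring_indexK ?groupM ?groupV ?enum_valP //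
           invMg mulgA.
Qed.

Definition left_regular_repr := MxRepresentation left_regular_mx_repr.

(* gset_mx F G A is the matrix of right multiplication by the sum of the elements
   of A, so its row space is the left ideal k[G] (\sum_(w in A) w). *)
Lemma gset_mx_module (A : {set gT}) :
  A \subset G -> mxmodule left_regular_repr (gset_mx F G A).
Proof.
move=> sAG; apply/mxmoduleP=> g Gg.
suff ->: gset_mx F G A *m left_regular_repr g
          = left_regular_repr g *m gset_mx F G A by exact: submxMl.
rewrite mulmx_suml mulmx_sumr; apply: eq_bigr => a Aa.
have Ga := subsetP sAG a Aa.
apply/row_matrixP=> i; rewrite !row_mul !rowK -!rowE !rowK.
by rewrite !gring_indexK ?groupM ?groupV ?enum_valP // mulgA.
Qed.

End GroupAlgebra.

Section Kostka.

Variables (F : fieldType) (gT : finGroupType) (W : {group gT}).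
Variables (n : nat) (s : 'I_n -> gT).

(* The row space of kostka_mx I is M_I = k[W] (\sum_(w in W_(~: I)) w). The
   intersection with W is vacuous when the s i lie in W. *)
Definition kostka_mx (I : {set 'I_n}) : 'M[F]_#|W| :=
  gset_mx F W (W :&: parabolic s (~: I)).

Lemma kostka_mx_module (I : {set 'I_n}) :
  mxmodule (left_regular_repr F W) (kostka_mx I).
Proof. exact/gset_mx_module/subsetIl. Qed.

Definition kostka_repr (I : {set 'I_n}) :=
  submod_repr (kostka_mx_module I).

Variables (d : nat) (V : mx_representation F W d).

Definition kostka (I : {set 'I_n}) : nat := dim_hom (kostka_repr I) V.

Definition small_kostka (I : {set 'I_n}) : int :=
  \sum_(J : {set 'I_n} | J \subset I)
     (-1) ^ (#|J|%:Z - #|I|%:Z) * (kostka J)%:Z.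

End Kostka.

Definition is_sign_repr (F : fieldType) (gT : finGroupType) (W : {group gT})
    (n : nat) (s : 'I_n -> gT) (eps : mx_representation F W 1) : Prop :=
  forall i, eps (s i) = (-1)%:M.

(* Such a representation exists, and its values on W are determined since the s i
   generate W. *)
Lemma sign_repr_exists (F : fieldType) (gT : finGroupType) (W : {group gT})
    (n : nat) (s : 'I_n -> gT) :
  coxeter_system W s -> exists eps : mx_representation F W 1, is_sign_repr s eps.
Proof.
case=> _ _ _ univ; have [i j | phi [phiM phis]] := univ {perm bool}
  (fun=> tperm false true); first by rewrite tperm2 expg1n.
have phi1 : phi 1%g = 1%g.
  by apply: (mulgI (phi 1%g)); rewrite -phiM ?group1 // !mulg1.
have epsP : mx_repr W (fun g => ((-1) ^+ odd_perm (phi g))%:M : 'M[F]_1).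
  split=> [|g h Wg Wh]; first by rewrite phi1 odd_perm1.
  by rewrite phiM // odd_permM signr_addb scalar_mxM.
by exists (MxRepresentation epsP) => i /=; rewrite phis odd_tperm.
Qed.

(* Main.v *)
Require Import Defs.
From HB Require Import structures.
From mathcomp Require Import all_boot all_order all_algebra all_fingroup all_solvable.
From mathcomp Require Import mxrepresentation character.
From mathcomp Require Import zify.

Set Implicit Arguments.
Unset Strict Implicit.
Unset Printing Implicit Defensive.

Import GRing.Theory.
Local Open Scope ring_scope.

(* By Frobenius reciprocity K_{V,J} is the dimension of the space V^K of vectors
   fixed by W_K, where K is the complement of J. Let a_J be the antisymmetrizer
   of W_J. The key fact is that the kernel of a_J on V^K is the sum of the
   V^{K + j}, j in J. It is checked on the functions W -> V, of which V is a
   retract, with the basis of indicators of the cosets W_{A(w)} w, where A(w) is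
   the set of left ascents of w: this basis is unitriangular for the length and
   adapted to all the spaces of W_K-invariants at once (Solomon). Hence
   r_V(K, J) := dim a_J(V^K) satisfies
     r_V(K, J) = r_V(K, J + j) + r_V(K + j, J)   (j not in J),
   so that kappa_{V,I} = r_V(complement of I, I) >= 0. The recursion is symmetric
   in K and J, and r_V(0, J) = r_{V^t}(J, 0) because a_J is, up to a scalar, the
   projection of V^t onto its W_J-invariants; so r_V(K, J) = r_{V^t}(J, K) for
   disjoint K and J, which is the duality. *)

(** * Frobenius reciprocity *)

(** A homomorphism is determined by the image of the generator [u], the sum of [H], and this image
    is fixed by [H]. Conversely a fixed [v] gives the map g |-> g v on the group algebra, which
    sends [u] to [#|H|] times [v], and [#|H|] is invertible. *)
Lemma dim_hom_gset (F : fieldType) (gT : finGroupType) (G H : {group gT})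
    (d : nat) (V : mx_representation F G d)
    (modH : mxmodule (left_regular_repr F G) (gset_mx F G H)) :
  [pchar F] =i pred0 -> H \subset G ->
  dim_hom (submod_repr modH) V = \rank (rfix_mx V H).
Proof.
move=> charF sHG; set U := gset_mx F G H; set L := left_regular_repr F G.
pose e g : 'rV[F]_#|G| := delta_mx 0 (gring_index G g).
have eL x g : x \in G -> e x *m L g = e (g^-1 * x)%g.
  by move=> Gx; rewrite -rowE rowK gring_indexK.
have rowU i : row i U = \sum_(a in H) e (enum_val i * a)%g.
  by rewrite [row i _]linear_sum; apply: eq_bigr => a _; apply: rowK.
pose u : 'rV_#|G| := \sum_(a in H) e a.
have uL g : g \in G -> u *m L g = row (gring_index G g^-1%g) U.
  move=> Gg; rewrite rowU gring_indexK ?groupV // mulmx_suml.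
  by apply: eq_bigr => a /(subsetP sHG) Ga; rewrite eL.
have uLH h : h \in H -> u *m L h = u.
  move=> Hh; rewrite mulmx_suml [RHS](reindex_inj (mulgI h^-1%g)) /=.
  apply: eq_big => [a | a Ha]; first by rewrite groupMl ?groupV.
  by rewrite eL ?(subsetP sHG).
have Uu : (u <= U)%MS.
  by rewrite -(mulmx1 u) -(repr_mx1 L) uL ?group1 // row_sub.
pose phi := lin1_mx (mulmx (in_submod U u) \o vec_mx) : 'M[F]_(_, d).
have phiE B : mxvec B *m phi = in_submod U u *m B by rewrite mul_rV_lin1 /= mxvecK.
have homu g (B : 'M_(\rank U, d)) :
    g \in G -> (mxvec B <= homs_mx (submod_repr modH) V)%MS ->
    in_submod U (u *m L g) *m B = in_submod U u *m B *m V g.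
  move=> Gg /homs_mxP/(_ g Gg) homB; rewrite (in_submodJ modH) // -[RHS]mulmxA -homB.
  exact/esym/mulmxA.
rewrite /dim_hom -(mxrank_mul_ker (homs_mx (submod_repr modH) V) phi).
rewrite [X in (_ + X)%N](_ : _ = 0%N); last first.
  apply/eqP; rewrite mxrank_eq0 -submx0; apply/rV_subP=> v.
  rewrite sub_capmx -(vec_mxK v); set B := vec_mx v => /andP[homB].
  move/sub_kermxP; rewrite phiE => uB0.
  suff -> : B = 0 by rewrite linear0 sub0mx.
  have full : row_full (in_submod U U) by rewrite /row_full mxrank_in_submod.
  apply: (row_full_inj full); rewrite mulmx0; apply/row_matrixP=> i.
  have Gi := enum_valP i; rewrite row_mul row0 in_submodE row_mul -in_submodE.
  rewrite -(gring_valK i) -[enum_val i]invgK -uL ?groupV // homu ?groupV //.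
  by rewrite uB0 mul0mx.
rewrite addn0; apply/eqP; rewrite eqn_leq; apply/andP; split; apply: mxrankS.
  apply/rV_subP=> _ /submxP[D ->]; rewrite mulmxA; set B := D *m _.
  have homB : (mxvec (vec_mx B) <= homs_mx (submod_repr modH) V)%MS.
    by rewrite vec_mxK submxMl.
  apply/rfix_mxP=> h Hh; rewrite -(vec_mxK B) phiE -homu ?uLH //.
  exact: subsetP sHG h Hh.
apply/rV_subP=> v fixv.
(* The map g |-> g v; on row vectors g acts through [V g^-1]. *)
pose C : 'M[F]_(#|G|, d) := \matrix_i (v *m V (enum_val i)^-1%g).
have eC g : g \in G -> e g *m C = v *m V g^-1%g.
  by move=> Gg; rewrite -rowE rowK gring_indexK.
have LC g : g \in G -> L g *m C = C *m V g.
  move=> Gg; apply/row_matrixP=> i; have Gi := enum_valP i.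
  rewrite !row_mul rowK -/(e _) eC ?groupM ?groupV // rowK -mulmxA.
  by rewrite -repr_mxM ?groupV // invMg invgK.
have homC : (mxvec (val_submod (1%:M : 'M_(\rank U)) *m C)
               <= homs_mx (submod_repr modH) V)%MS.
  apply/homs_mxP=> g Gg.
  rewrite mulmxA -val_submodE -(mul1mx (submod_repr modH g)) (val_submodJ modH) //.
  by rewrite -!mulmxA LC.
have uC : u *m C = #|H|%:R *: v.
  rewrite mulmx_suml (eq_bigr (fun=> v)) ?sumr_const ?scaler_nat // => a Ha.
  by rewrite eC ?(subsetP sHG) // (rfix_mxP H fixv) ?groupV.
have nzH : #|H|%:R != 0 :> F by rewrite ((pcharf0P F).1 charF) -lt0n cardG_gt0.
rewrite -(eqmx_scale v nzH) -uC -(in_submodK Uu) val_submodE -mulmxA -phiE.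
exact: submxMr.
Qed.

Lemma kostkaE (F : fieldType) (gT : finGroupType) (W : {group gT})
    (n : nat) (s : 'I_n -> gT) (d : nat) (V : mx_representation F W d)
    (I : {set 'I_n}) :
  [pchar F] =i pred0 -> parabolic s (~: I) \subset W ->
  kostka s V I = \rank (rfix_mx V (parabolic s (~: I))).
Proof.
move=> charF sPW; rewrite /kostka (@dim_hom_gset F gT W (W :&: parabolic s (~: I))%G) //.
  by rewrite /= (setIidPr sPW).
exact: subsetIl.
Qed.

(** * Auxiliary facts on tensor products, invariants and words *)

(** The cast is there because [d * 1] and [d] agree only through [muln1]. As [tprod] is recursive,
    entries are matched by the values of their indices. *)
Lemma tprod_scalar (F : fieldType) (d : nat) (A : 'M[F]_d) (B : 'M[F]_1) :
  tprod A B = castmx (esym (muln1 d), esym (muln1 d)) (B 0 0 *: A).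
Proof.
have trowE n1 (v : 'rV[F]_n1) (j : 'I_(n1 * 1)) (k : 'I_n1) :
    k = j :> nat -> trow v B 0 j = B 0 0 * v 0 k.
  elim: n1 v j k => [|n1 IHn] v j k jk; first by case: k {jk}.
  rewrite /= mxE; case: splitP => j' jE.
    rewrite !mxE mulrC !ord1; congr (_ * v 0 _); apply: val_inj.
    by rewrite /= jk jE ord1.
  have lt_j' : (j' < n1)%N by have := ltn_ord j'; lia.
  rewrite (IHn _ _ (Ordinal lt_j')) // mxE; congr (_ * v 0 _).
  by apply: val_inj; rewrite /= jk jE.
have tprodE m1 n1 (C : 'M[F]_(m1, n1)) (i : 'I_(m1 * 1)) (j : 'I_(n1 * 1))
    (i' : 'I_m1) (j' : 'I_n1) :
    i' = i :> nat -> j' = j :> nat -> tprod C B i j = B 0 0 * C i' j'.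
  elim: m1 C i i' => [|m1 IHm] C i i' ii' jj'; first by case: i' {ii'}.
  rewrite /= mxE; case: splitP => k iE.
    rewrite ord1 (trowE _ _ _ _ jj') mxE; congr (_ * C _ j'); apply: val_inj.
    by rewrite /= ii' iE ord1.
  have lt_k : (k < m1)%N by have := ltn_ord k; lia.
  rewrite (IHm _ _ (Ordinal lt_k)) // mxE; congr (_ * C _ j').
  by apply: val_inj; rewrite /= ii' iE.
apply/matrixP=> i j; rewrite castmxE mxE.
exact: tprodE.
Qed.

Lemma rank_castmx (F : fieldType) m n m' n' (eq_mn : (m = m') * (n = n'))
  (A : 'M[F]_(m, n)) : \rank (castmx eq_mn A) = \rank A.
Proof. by case: eq_mn => eqm eqn; case: _ / eqm; case: _ / eqn. Qed.

(** The sum over [H] acts as [#|H|] times a projection onto the invariants. *)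
Lemma rfix_mx_sum (F : fieldType) (gT : finGroupType) (G H : {group gT})
    (d : nat) (V : mx_representation F G d) :
  [pchar F] =i pred0 -> H \subset G ->
  (rfix_mx V H :=: (\sum_(h in H) V h)%R)%MS.
Proof.
move=> charF sHG; apply/eqmxP/andP; split; last first.
  apply/rfix_mxP=> h Hh; rewrite mulmx_suml [RHS](reindex_inj (mulIg h)) /=.
  apply: eq_big => [x | x Hx]; first by rewrite groupMr.
  by rewrite repr_mxM ?(subsetP sHG).
apply/rV_subP=> v fixv.
have nzH : #|H|%:R != 0 :> F by rewrite ((pcharf0P F).1 charF) -lt0n cardG_gt0.
suff vE : #|H|%:R *: v = v *m (\sum_(h in H) V h)%R.
  by rewrite -(eqmx_scale v nzH) vE submxMl.
rewrite mulmx_sumr (eq_bigr (fun=> v)) ?sumr_const ?scaler_nat // => h Hh.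
by rewrite (rfix_mxP H fixv).
Qed.

(** Tells in which factor of a word the exchange condition deletes a letter. *)
Lemma cat_eq_cat_cons (T : Type) (a c u1 u2 : seq T) j :
  a ++ c = u1 ++ j :: u2 ->
  (exists2 a2, a = u1 ++ j :: a2 & u2 = a2 ++ c) \/
  (exists2 c1, u1 = a ++ c1 & c = c1 ++ j :: u2).
Proof.
elim: a u1 => [|x a IHa] [|y u1] /=; first by right; exists [::].
- by move=> ->; right; exists (y :: u1).
- by case=> -> <-; left; exists a.
case=> -> /IHa[] [v ->]; first by move=> ->; left; exists v.
by move=> ->; right; exists v.
Qed.

(** * Words and inversions in a Coxeter group *)

Section Coxeter.

Local Open Scope group_scope.

Variables (gT : finGroupType) (W : {group gT}) (n : nat) (s : 'I_n -> gT).
Hypothesis coxW : coxeter_system W s.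

Definition wprod (u : seq 'I_n) : gT := \prod_(i <- u) s i.

Lemma wprod_cat u v : wprod (u ++ v) = wprod u * wprod v.
Proof. exact: big_cat. Qed.

Lemma wprod_cons i u : wprod (i :: u) = s i * wprod u.
Proof. exact: big_cons. Qed.

Lemma wprod_nil : wprod [::] = 1.
Proof. exact: big_nil. Qed.

Lemma mulss i : s i * s i = 1.
Proof. by have [_ /(_ i) o_si _ _] := coxW; rewrite -expg2 -o_si expg_order. Qed.

Lemma mulssK i x : s i * (s i * x) = x.
Proof. by rewrite mulgA mulss mul1g. Qed.

Lemma invs i : (s i)^-1 = s i.
Proof. by apply: (mulgI (s i)); rewrite mulgV mulss. Qed.

Lemma memsW i : s i \in W.
Proof. by have [_ _ <- _] := coxW; rewrite mem_gen ?imset_f. Qed.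

Lemma parabolicS (J K : {set 'I_n}) : J \subset K ->
  parabolic s J \subset parabolic s K.
Proof. by move=> sJK; rewrite genS ?imsetS. Qed.

Lemma parabolicT : parabolic s setT = W :> {set gT}.
Proof.
have [_ _ <- _] := coxW; congr <<_>>; apply/setP=> x.
by apply/imsetP/imsetP=> -[i _ ->]; exists i; rewrite ?inE.
Qed.

Lemma parabolic_sub J : parabolic s J \subset W.
Proof. by rewrite -parabolicT parabolicS ?subsetT. Qed.

Lemma mem_parabolic (J : {set 'I_n}) i : i \in J -> s i \in parabolic s J.
Proof. by move=> Ji; rewrite mem_gen ?imset_f. Qed.

Lemma wprod_parabolic (J : {set 'I_n}) u :
  all (mem J) u -> wprod u \in parabolic s J.
Proof.
elim: u => [|i u IHu] /=; first by rewrite wprod_nil group1.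
by case/andP=> Ji Ju; rewrite wprod_cons groupM ?IHu ?mem_parabolic.
Qed.

Lemma wprodW u : wprod u \in W.
Proof. by rewrite -parabolicT wprod_parabolic //; apply/allP=> i _; apply: in_setT. Qed.

Lemma wprod_rev u : wprod (rev u) = (wprod u)^-1.
Proof.
elim: u => [|i u IHu]; first by rewrite wprod_nil invg1.
by rewrite rev_cons -cats1 wprod_cat IHu !wprod_cons wprod_nil mulg1 invMg invs.
Qed.

Lemma parabolic_word (J : {set 'I_n}) x :
  x \in parabolic s J -> exists2 u, all (mem J) u & wprod u = x.
Proof.
case/gen_prodgP=> m [c Jc ->]; elim: m c Jc => [|m IHm] c Jc.
  by exists [::]; rewrite // wprod_nil big_ord0.
have [i Ji cE] := imsetP (Jc ord0).
have [|u Ju uE] := IHm (fun k => c (lift ord0 k)); first by move=> k.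
by exists (i :: u); rewrite /= ?Ji // wprod_cons uE -cE big_ord_recl.
Qed.

(** Minimality is among words in [J] only. Tuples of a given length form a finite type, so a shorter
    word can be searched for. *)
Lemma parabolic_min_word {J : {set 'I_n}} {x} : x \in parabolic s J ->
  exists u, [/\ all (mem J) u, wprod u = x &
    forall v, all (mem J) v -> wprod v = wprod u -> (size u <= size v)%N].
Proof.
case/parabolic_word=> u; have [m] := ubnP (size u).
elim: m u => // m IHm u le_um Ju uE.
pose P (k : 'I_(size u)) :=
  [exists t : k.-tuple 'I_n, all (mem J) t && (wprod t == x)].
have [/existsP[k /existsP[t /andP[Jt /eqP tE]]] | /existsPn noP] :=
    boolP [exists k, P k].
  apply: (IHm t) => //; rewrite size_tuple.
  by apply: leq_trans (ltn_ord k) _; rewrite -ltnS.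
exists u; split=> // v Jv vE; rewrite leqNgt; apply/negP=> lt_vu.
case/existsP: (noP (Ordinal lt_vu)); exists (in_tuple v).
by rewrite Jv vE uE eqxx.
Qed.

(* The sign bit of the action of W on {reflections} x {+1,-1}: the letters of a
   word for w contribute [t == s_1 ... s_j ... s_1], so it records whether t is
   an inversion of w. *)
Lemma inversion_cocycle : exists N : gT -> gT -> bool,
  (forall t, N 1 t = false) /\
  (forall i w t, w \in W -> N (s i * w) t = (t == s i) (+) N w (t ^ s i)).
Proof.
have [_ _ _ univ] := coxW.
(* All of [gT] replaces the set of reflections, which avoids a subtype. *)
pose f i (p : gT * bool) : gT * bool := (p.1 ^ s i, p.2 (+) (p.1 == s i)).
have fK i : involutive (f i).
  case=> t b; rewrite /f /= -conjgM mulss conjg1; congr (_, _).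
  have -> : (t ^ s i == s i) = (t == s i).
    by rewrite -[X in _ == X](mulKg (s i) (s i)) (inj_eq (@conjg_inj _ (s i))).
  by rewrite -addbA addbb addbF.
pose fp i : {perm gT * bool} := perm (can_inj (fK i)).
pose c i j (t : gT) k := t == (s i * s j) ^+ k * s i.
have fpM i j m t b : ((fp i * fp j) ^+ m) (t, b) =
    (t ^ (s i * s j) ^+ m,
     b (+) odd (\sum_(0 <= k < m.*2) c i j t k)%N).
  elim: m => [|m IHm] in t b *.
    by rewrite big_geq //= conjg1 perm1 addbF.
  have rs : s i * ((s i * s j) ^+ m)^-1 = (s i * s j) ^+ m * s i.
    suff: ((s i * s j) ^+ m) ^ s i = ((s i * s j) ^+ m)^-1.
      by move=> <-; rewrite conjgE invs mulssK.
    by rewrite conjXg -expgVn invMg !invs conjgE invs -!mulgA mulssK.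
  have conjE x y : (t ^ x == y) = (t == x * y * x^-1).
    by rewrite (can2_eq (conjgK _) (conjgKV _)) conjgE invgK mulgA.
  rewrite expgSr permM IHm permM !permE /f /= -!conjgM.
  rewrite doubleS !big_nat_recr //= !oddD !oddb -!addbA -expgSr.
  congr (_, _ (+) (_ (+) (_ (+) _))); rewrite /c !conjE.
    by rewrite -mulgA rs mulgA -expgD addnn.
  congr (_ == _); rewrite invMg !invs -!mulgA rs expgSr -addnn expgD -!mulgA.
  rewrite (mulgA (s i) (s j) (_ ^+ m * _)) (mulgA (s i * s j)).
  by rewrite -expgS expgSr -!mulgA.
(* [c i j t] has period [#[s i * s j]] and is summed over two periods, so the sign flips an even
   number of times. *)
have fpR i j : (fp i * fp j) ^+ #[s i * s j] = 1.
  apply/permP=> -[t b]; rewrite fpM expg_order conjg1 perm1; congr (_, _).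
  rewrite -addnn (big_cat_nat (n := #[s i * s j])) ?leq_addr //=.
  rewrite -[X in \sum_(X <= _ < (_ + _)%N) _]add0n big_addn addnK.
  rewrite [X in (_ + X)%N](eq_bigr (fun k => c i j t k : nat)).
    by rewrite addnn odd_double addbF.
  by move=> k _; rewrite /c expgD expg_order mulg1.
have [phi [phiM phis]] := univ _ fp fpR.
have phi1 : phi 1 = 1 by apply: (mulgI (phi 1)); rewrite -phiM ?group1 // !mulg1.
exists (fun w t => (phi w (t, false)).2); split=> [t | i w t Ww].
  by rewrite phi1 perm1.
have phib t' b : (phi w (t', b)).2 = b (+) (phi w (t', false)).2.
  have [u _ <-] : exists2 u, true & wprod u = w.
    by move: Ww; rewrite -parabolicT => /parabolic_word[u _ <-]; exists u.
  elim: u t' b => [|j u IHu] t' b; first by rewrite wprod_nil phi1 !perm1 /= addbF.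
  rewrite wprod_cons phiM ?memsW ?wprodW // phis !permM !permE /f /=.
  by rewrite [in LHS]IHu [in RHS]IHu addbA.
by rewrite phiM ?memsW // permM phis permE /f /= phib.
Qed.


(** * Length and the exchange condition *)

Let wordb (w : gT) k := [exists u : k.-tuple 'I_n, wprod u == w].

Let ex_wordb w : w \in W -> exists k, wordb w k.
Proof.
rewrite -parabolicT => /parabolic_word[u _ <-].
by exists (size u); apply/existsP; exists (in_tuple u).
Qed.

(** The value 0 outside [W] is a default that makes [len] total. *)
Definition len (w : gT) : nat :=
  if @idP (w \in W) is ReflectT Ww then ex_minn (ex_wordb Ww) else 0.

Lemma len_word w : w \in W -> exists2 u, wprod u = w & size u = len w.
Proof.
move=> Ww; rewrite /len; case: {-}_ / idP => // Ww'.
case: ex_minnP => m /existsP[u /eqP uE] _; exists u => //.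
by rewrite size_tuple.
Qed.

Lemma len_wprod u : (len (wprod u) <= size u)%N.
Proof.
rewrite /len; case: {-}_ / idP => // Ww; case: ex_minnP => m _; apply.
by apply/existsP; exists (in_tuple u).
Qed.

Lemma lenM x y : x \in W -> y \in W -> (len (x * y) <= len x + len y)%N.
Proof.
move=> /len_word[u <- <-] /len_word[v <- <-].
by rewrite -wprod_cat -size_cat len_wprod.
Qed.

Lemma lenV x : x \in W -> len x^-1 = len x.
Proof.
have leV y : y \in W -> (len y^-1 <= len y)%N.
  by move=> /len_word[u <- <-]; rewrite -wprod_rev -size_rev len_wprod.
by move=> Wx; apply/eqP; rewrite eqn_leq leV // -{1}[x]invgK leV ?groupV.
Qed.

(** If [N] marks t as an inversion of a word, multiplying by t deletes a letter of it. Exactly one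
    of w and s_i w has s_i as an inversion; were it s_i w, deleting a letter from a reduced word of
    s_i w would make w shorter than s_i w. *)
Lemma exchange i w u : wprod u = w -> (len (s i * w) <= len w)%N ->
  exists u1 j u2, u = u1 ++ j :: u2 /\ s i * w = wprod (u1 ++ u2).
Proof.
have [N [N1 NS]] := inversion_cocycle.
have NP t v : N (wprod v) t -> exists v1 j v2,
    v = v1 ++ j :: v2 /\ t * wprod v = wprod (v1 ++ v2).
  elim: v t => [|j v IHv] t; first by rewrite wprod_nil N1.
  rewrite wprod_cons NS ?wprodW //; have [-> _ | _ /= /IHv] := eqVneq t (s j).
    by exists [::], j, v; rewrite mulssK.
  case=> v1 [k [v2 [-> vE]]]; exists (j :: v1), k, v2; split=> //.
  by rewrite cat_cons wprod_cons -vE conjgE invs !mulgA mulss mul1g.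
move=> <-{w} le_sw; apply: (NP); apply: contraLR le_sw => notN.
have [v vE <-] : exists2 v, wprod v = s i * wprod u & size v = len (s i * wprod u).
  by apply: len_word; rewrite groupM ?memsW ?wprodW.
have : N (wprod v) (s i).
  by rewrite vE NS ?wprodW // eqxx conjgE invs mulssK (negPf notN).
case/NP=> v1 [j [v2 [vS]]]; rewrite vE mulssK vS => ->.
by rewrite -ltnNge (leq_ltn_trans (len_wprod _)) // !size_cat addnS.
Qed.

(** * Shortest and longest elements of parabolic cosets *)

(** Induction on [a]: exchange for s_i deletes a letter of [a ++ c]. It cannot lie in [a], by
    minimality of [i :: a], so it lies in [c], and s_i takes its place at the front. *)
Lemma descents_prefix (J : {set 'I_n}) w a : w \in W ->
  (forall i, i \in J -> (len (s i * w) <= len w)%N) ->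
  all (mem J) a ->
  (forall v, all (mem J) v -> wprod v = wprod a -> (size a <= size v)%N) ->
  exists2 c, w = wprod (a ++ c) & (size a + size c)%N = len w.
Proof.
move=> Ww desc; elim: a => [|i a IHa] /=.
  by have [u <- <-] := len_word Ww; exists u.
case/andP=> Ji Ja min_ia.
have min_a v : all (mem J) v -> wprod v = wprod a -> (size a <= size v)%N.
  move=> Jv vE; rewrite -ltnS; apply: (min_ia (i :: v)); rewrite /= ?Ji //.
  by rewrite !wprod_cons vE.
have [c wE szc] := IHa Ja min_a.
have [u1 [j [u2 [acE swE]]]] := exchange (esym wE) (desc i Ji).
have [[a2 aE u2E] | [c1 u1E cE]] := cat_eq_cat_cons acE.
  have Ja' : all (mem J) (u1 ++ a2).
    by move: Ja; rewrite aE !all_cat /= => /and3P[-> _ ->].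
  suff /(min_ia _ Ja') : wprod (u1 ++ a2) = wprod (i :: a).
    by rewrite aE !size_cat /= addnS ltnNge leqnSn.
  apply: (mulIg (wprod c)).
  by rewrite -wprod_cat -catA -u2E -swE wE wprod_cons -mulgA -wprod_cat.
exists (c1 ++ u2); first by rewrite wprod_cons catA -u1E -swE mulssK.
by rewrite -szc cE !size_cat /= addnS addSn addnS.
Qed.

(** A minimal word of x^-1 starts a reduced word of w, and multiplying by x removes this prefix. *)
Lemma descents_max (J : {set 'I_n}) w x : w \in W ->
  (forall i, i \in J -> (len (s i * w) <= len w)%N) ->
  x \in parabolic s J -> x != 1 -> (len (x * w) < len w)%N.
Proof.
move=> Ww desc; rewrite -groupV => /parabolic_min_word[a [Ja aE min_a]] nt_x.
have [c wE <-] := descents_prefix Ww desc Ja min_a.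
rewrite wE wprod_cat aE mulKVg (leq_ltn_trans (len_wprod c)) //.
rewrite -{1}[size c]add0n ltn_add2r lt0n; apply: contraNneq nt_x => /size0nil a0.
by rewrite -eq_invg1 -aE a0 wprod_nil.
Qed.

(** For y of maximal length all generators are descents, so a minimal word of z^-1 starts a reduced
    word of y. *)
Lemma longest_element :
  exists2 y, y \in W & forall z, z \in W -> (len (z * y) + len z)%N = len y.
Proof.
case: (arg_maxnP len (group1 W)) => y Wy max_y; exists y => // z Wz.
have : z^-1 \in parabolic s setT by rewrite parabolicT groupV.
case/parabolic_min_word=> a [Ja aE min_a].
have [|c yE szc] := descents_prefix Wy _ Ja min_a.
  by move=> i _; apply/max_y/groupM; rewrite ?memsW.
have zyE : z * y = wprod c by rewrite yE wprod_cat aE mulKVg.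
apply/eqP; rewrite eqn_leq; apply/andP; split.
  by rewrite -szc addnC zyE -(lenV Wz) -aE leq_add ?len_wprod.
by rewrite -{1}(mulKg z y) addnC -(lenV Wz) lenM ?groupV // groupM.
Qed.

(** Right multiplication by the longest element reverses lengths, which reduces the claim to
    [descents_max]. *)
Lemma ascents_min (J : {set 'I_n}) w x : w \in W ->
  (forall i, i \in J -> (len w <= len (s i * w))%N) ->
  x \in parabolic s J -> x != 1 -> (len w < len (x * w))%N.
Proof.
move=> Ww asc Jx nt_x; have Wx := subsetP (parabolic_sub J) x Jx.
have [y Wy lenMy] := longest_element.
rewrite -(ltn_add2l (len (x * w * y))) lenMy ?groupM // -(lenMy _ Ww) ltn_add2r.
rewrite -mulgA; apply: descents_max Jx nt_x; first exact: groupM.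
move=> i Ji; rewrite mulgA -(leq_add2r (len w)) lenMy //.
by rewrite -(lenMy (s i * w)) ?groupM ?memsW // leq_add2l asc.
Qed.


End Coxeter.

(** * Invariants and antisymmetrizers *)

Section InvariantSpaces.

Variables (F : fieldType) (gT : finGroupType) (W : {group gT}).
Variables (n : nat) (s : 'I_n -> gT) (eps : mx_representation F W 1).
Hypotheses (charF : [pchar F] =i pred0) (coxW : coxeter_system W s).
Hypothesis epsP : is_sign_repr s eps.

Let sgn x : F := eps x 0 0.

Lemma sgn1 : sgn 1%g = 1.
Proof. by rewrite /sgn repr_mx1 mxE. Qed.

Lemma sgnM : {in W &, {morph sgn : x y / (x * y)%g >-> x * y}}.
Proof.
by move=> x y Wx Wy; rewrite /sgn repr_mxM // mxE big_ord1.
Qed.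

Lemma sgn_gen i : sgn (s i) = -1.
Proof. by rewrite /sgn epsP mxE. Qed.

Lemma eq_opp0 (M : lmodType F) (v : M) : v = - v -> v = 0.
Proof.
move/eqP; rewrite -subr_eq0 opprK -mulr2n -scaler_nat scaler_eq0.
by rewrite ((pcharf0P F).1 charF) => /eqP.
Qed.

Section Representation.

Variables (d : nat) (V : mx_representation F W d).

Local Notation fix_ J := (rfix_mx V (parabolic s J)).

Definition alt_mx (J : {set 'I_n}) : 'M[F]_d :=
  \sum_(x in parabolic s J) sgn x *: V x.

Lemma rfix_parabolicP m (A : 'M_(m, d)) (J : {set 'I_n}) :
  reflect (forall i, i \in J -> A *m V (s i) = A) (A <= fix_ J)%MS.
Proof.
apply: (iffP (rfix_mxP _)) => [fixA i Ji | fixA x /parabolic_word[u Ju <-{x}]].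
  by rewrite fixA ?mem_parabolic.
elim: u Ju => [|i u IHu] /=; first by rewrite wprod_nil repr_mx1 mulmx1.
case/andP=> Ji Ju; rewrite wprod_cons repr_mxM ?(memsW coxW) ?(wprodW coxW) //.
by rewrite mulmxA fixA ?IHu.
Qed.

(** The retraction of functions W -> V onto V: on the orbit function of v it gives [#|W|] times
    v. *)
Definition average (f : gT -> 'rV[F]_d) : 'rV[F]_d :=
  \sum_(w in W) f w *m V w^-1%g.

Definition left_invariant (J : {set 'I_n}) (f : gT -> 'rV[F]_d) :=
  forall i, i \in J -> forall w, w \in W -> f (s i * w)%g = f w.

(** Says that a_J kills [f] when acting by left translations of the argument. *)
Definition alternating_free (J : {set 'I_n}) (f : gT -> 'rV[F]_d) :=
  forall w, w \in W -> \sum_(x in parabolic s J) sgn x *: f (x * w)%g = 0.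

Lemma average_invariant J f : left_invariant J f -> (average f <= fix_ J)%MS.
Proof.
move=> invf; apply/rfix_parabolicP=> i Ji; rewrite /average mulmx_suml.
rewrite (reindex_inj (mulgI (s i))); apply: eq_big => [w | w Ww].
  by rewrite groupMl ?(memsW coxW).
have Ww' : w \in W by rewrite -(groupMl _ (memsW coxW i)).
rewrite invf // -mulmxA -repr_mxM ?groupV ?(memsW coxW) //.
by rewrite invMg (invs coxW) -mulgA (mulss coxW) mulg1.
Qed.

(** The substitution x |-> s_i x turns the alternating sum into its opposite. *)
Lemma invariant_alternating_free (J : {set 'I_n}) i f :
  i \in J -> left_invariant [set i] f -> alternating_free J f.
Proof.
move=> Ji invf w Ww; have Jsi := mem_parabolic s Ji; apply: eq_opp0.
rewrite {1}(reindex_inj (mulgI (s i))) -sumrN; apply: eq_big => [x | x].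
  by rewrite groupMl.
rewrite groupMl // => Jx; have Wx := subsetP (parabolic_sub coxW J) x Jx.
rewrite sgnM ?(memsW coxW) // sgn_gen mulN1r scaleNr -mulgA.
by rewrite invf ?set11 ?groupM.
Qed.

Let asc w := [set i | (len coxW w <= len coxW (s i * w)%g)%N].

(* Subtract from f, level by level in the length, the W_{asc w}-invariant
   functions supported on W_{asc w} w; since w is the shortest element of this
   coset, they form a unitriangular family. *)
Lemma average_alternating_free (J K : {set 'I_n}) f :
  left_invariant K f -> alternating_free J f ->
  (average f <= \sum_(j in J) fix_ (j |: K))%MS.
Proof.
set U := (\sum_(j in J) _)%MS.
pose b f w u : 'rV[F]_d :=
  if (u * w^-1)%g \in parabolic s (asc w) then f w else 0.
have b_inv g w : w \in W -> left_invariant (asc w) (b g w).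
  by move=> Ww i wi u _; rewrite /b -mulgA groupMl ?mem_parabolic.
have b_supp g w u : w \in W -> (len coxW u <= len coxW w)%N -> u != w ->
    b g w u = 0.
  move=> Ww le_uw neq_uw; rewrite /b; case: ifP => // wP.
  have ascw i : i \in asc w -> (len coxW w <= len coxW (s i * w)%g)%N by rewrite inE.
  have := ascents_min Ww ascw wP.
  by rewrite mulgKV ltnNge le_uw -eq_mulgV1 => /(_ neq_uw).
(* [g] vanishes below length [m], and [k] bounds the number of levels left. *)
suff gen k m g : left_invariant K g -> alternating_free J g ->
    (forall w, w \in W -> len coxW w < m + k)%N ->
    (forall w, w \in W -> (len coxW w < m)%N -> g w = 0) ->
    (average g <= U)%MS.
  move=> invf altf; apply: (gen (\max_(w in W) len coxW w).+1 0%N) => // w Ww.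
  by rewrite add0n ltnS (leq_bigmax_cond w).
elim: k m g => [|k IHk] m g invg altg lt_len g0.
  rewrite /average big1 ?sub0mx // => w Ww; rewrite g0 ?mul0mx //.
  by rewrite -(addn0 m) lt_len.
pose D w := (w \in W) && (len coxW w == m).
(* A descent i in [K] would give g w = g (s_i w) = 0 by vanishing below [m]. Were all of [J]
   descents, w would be longest in W_J w and the alternating sum would reduce to g w. *)
have bD w : D w -> g w != 0 -> K \subset asc w /\ exists2 j, j \in J & j \in asc w.
  case/andP=> Ww /eqP wm nz_gw; split.
    apply/subsetP=> i Ki; rewrite inE leqNgt wm; apply: contra nz_gw => lt_m.
    by rewrite -(invg i Ki w Ww) g0 // groupM ?(memsW coxW).
  apply/exists_inP; apply: contraR nz_gw => /exists_inPn noJ.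
  have := altg w Ww; rewrite (bigD1 1%g) //= sgn1 scale1r mul1g big1 ?addr0 => [-> //|].
  move=> x /andP[Jx nt_x]; rewrite g0 ?scaler0 //.
    by rewrite groupM // (subsetP (parabolic_sub coxW J)).
  rewrite -wm; apply: descents_max Jx nt_x => // i /noJ.
  by rewrite inE -ltnNge => /ltnW.
(* By [bD] each nonzero term is invariant under [K] and some j in [J], so [h] keeps both properties
   of [g], and the average of the term lies in the required sum. *)
pose h u := g u - \sum_(w | D w) b g w u.
have avg_h : average g = average h + \sum_(w | D w) average (b g w).
  rewrite /average exchange_big /= -big_split /=; apply: eq_bigr => u Wu.
  by rewrite -mulmx_suml -mulmxDl subrK.
have b0 w : g w = 0 -> forall u, b g w u = 0.
  by move=> gw0 u; rewrite /b gw0 if_same.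
rewrite avg_h addmx_sub //.
  apply: (IHk m.+1) => [i Ki w Ww | w Ww | w Ww | w Ww].
  - rewrite /h invg //; congr (_ - _); apply: eq_bigr => u Du.
    have [/b0 bu0 | /(bD u Du)[sKu _]] := eqVneq (g u) 0; first by rewrite !bu0.
    by rewrite b_inv ?(subsetP sKu) //; case/andP: Du.
  - rewrite (eq_bigr (fun x => sgn x *: g (x * w)%g
                        - \sum_(u | D u) sgn x *: b g u (x * w)%g)); last first.
      by move=> x _; rewrite scalerBr scaler_sumr.
    rewrite big_split /= altg // add0r sumrN exchange_big big1 ?oppr0 //= => u Du.
    have [/b0 bu0 | /(bD u Du)[_ [j Jj uj]]] := eqVneq (g u) 0.
      by rewrite big1 // => x _; rewrite bu0 scaler0.
    apply: (invariant_alternating_free Jj) => // i /set1P-> v Wv.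
    by rewrite b_inv //; case/andP: Du.
  - by rewrite addSnnS lt_len.
  rewrite ltnS /h => le_wm; have [Dw | notDw] := boolP (D w).
    rewrite (bigD1 w) //= {1}/b mulgV group1 big1 ?addr0 ?subrr // => u.
    case/andP=> /andP[Wu /eqP um] neq_uw; apply: b_supp; rewrite ?um //.
    by rewrite eq_sym.
  rewrite g0 // ?big1 ?subrr // => [u Du|].
    have /andP[Wu /eqP um] := Du; apply: b_supp; rewrite ?um //.
    by apply: contraNneq notDw => ->.
  by rewrite ltn_neqAle le_wm andbT; apply: contra notDw => wm; rewrite /D Ww.
apply: summx_sub => w Dw; have [gw0 | /(bD w Dw)[sKw [j Jj wj]]] := eqVneq (g w) 0.
  by rewrite /average big1 ?sub0mx // => u _; rewrite b0 ?mul0mx.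
apply: (sumsmx_sup j Jj); apply: average_invariant => i Ki; apply: b_inv.
  by case/andP: Dw.
by case/setU1P: Ki => [-> // | /(subsetP sKw)].
Qed.

(** The orbit function of a vector v in the left side satisfies the hypotheses of
    [average_alternating_free], and its average is a nonzero multiple of v. Conversely a_J kills
    whatever s_j fixes. *)
Lemma fix_cap_ker_alt (J K : {set 'I_n}) :
  (fix_ K :&: kermx (alt_mx J) :=: \sum_(j in J) fix_ (j |: K))%MS.
Proof.
pose orb v w : 'rV[F]_d := v *m V w.
have orb_inv L v : (v <= fix_ L)%MS -> left_invariant L (orb v).
  move=> /rfix_parabolicP fixv i Li w Ww.
  by rewrite /orb repr_mxM ?(memsW coxW) // mulmxA fixv.
have orb_alt v w : w \in W ->
    v *m alt_mx J *m V w = \sum_(x in parabolic s J) sgn x *: orb v (x * w)%g.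
  move=> Ww; rewrite mulmx_sumr mulmx_suml; apply: eq_bigr => x Jx.
  rewrite -scalemxAr -scalemxAl -mulmxA -repr_mxM //.
  exact: subsetP (parabolic_sub coxW J) x Jx.
apply/eqmxP/andP; split.
  apply/rV_subP=> v; rewrite sub_capmx => /andP[fixv /sub_kermxP altv].
  have avgE : average (orb v) = #|W|%:R *: v.
    rewrite /average (eq_bigr (fun=> v)) ?sumr_const ?scaler_nat // => w Ww.
    by rewrite /orb -mulmxA -repr_mxM ?groupV // mulgV repr_mx1 mulmx1.
  rewrite -(eqmx_scale _ (_ : #|W|%:R != 0 :> F)); last first.
    by rewrite ((pcharf0P F).1 charF) -lt0n cardG_gt0.
  rewrite -avgE; apply: average_alternating_free; first exact: orb_inv.
  by move=> w Ww; rewrite -orb_alt // altv mul0mx.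
apply/sumsmx_subP=> j Jj; apply/rV_subP=> u fixu.
have sK : K \subset j |: K by apply: subsetUr.
rewrite sub_capmx (submx_trans fixu) ?rfix_mxS ?parabolicS //=.
apply/sub_kermxP; rewrite -[LHS]mulmx1 -(repr_mx1 V) orb_alt //.
apply: (invariant_alternating_free Jj) => //; apply: orb_inv.
by apply: submx_trans fixu _; rewrite rfix_mxS ?parabolicS ?subsetUl.
Qed.

(** * The ranks r_V(K, J) and their recursion *)

Definition mixed_rank (K J : {set 'I_n}) : nat := \rank (fix_ K *m alt_mx J).

(** By [fix_cap_ker_alt], adding j to [J] enlarges the kernel on V^K by V^{K + j}, which meets the
    old kernel in the kernel of a_J on V^{K + j}. Rank-nullity does the rest. *)
Lemma mixed_rankS (K J : {set 'I_n}) j : j \notin J ->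
  mixed_rank K J = (mixed_rank K (j |: J) + mixed_rank (j |: K) J)%N.
Proof.
move=> notJj.
have eqN : (fix_ K :&: kermx (alt_mx (j |: J)) :=:
            fix_ K :&: kermx (alt_mx J) + fix_ (j |: K))%MS.
  apply: eqmx_trans (fix_cap_ker_alt _ _) _; rewrite big_setU1 //=.
  by rewrite addsmxC; apply: adds_eqmx (eqmx_sym (fix_cap_ker_alt _ _)) _.
have eqI : (fix_ K :&: kermx (alt_mx J) :&: fix_ (j |: K) :=:
            fix_ (j |: K) :&: kermx (alt_mx J))%MS.
  rewrite capmxC capmxA; apply: cap_eqmx => //; apply: eqmx_sym.
  apply/eqmxP; rewrite capmxSl sub_capmx submx_refl.
  by rewrite rfix_mxS ?parabolicS ?subsetUr.
have := mxrank_sum_cap (fix_ K :&: kermx (alt_mx J))%MS (fix_ (j |: K)).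
rewrite eqI -eqN.
have := mxrank_mul_ker (fix_ K) (alt_mx J).
have := mxrank_mul_ker (fix_ K) (alt_mx (j |: J)).
have := mxrank_mul_ker (fix_ (j |: K)) (alt_mx J).
by rewrite -!/(mixed_rank _ _); lia.
Qed.

Lemma mixed_rank0 (K : {set 'I_n}) : mixed_rank K set0 = \rank (fix_ K).
Proof.
rewrite /mixed_rank /alt_mx /= imset0 gen0 big_set1.
by rewrite sgn1 scale1r repr_mx1 mulmx1.
Qed.

(** The recursion, solved for the larger [J], splits the subsets L by whether they contain j. *)
Lemma mixed_rank_sum (K J : {set 'I_n}) :
  (mixed_rank K J)%:Z =
  \sum_(L : {set 'I_n} | L \subset J)
     (-1) ^+ #|L| * (\rank (fix_ (K :|: L)))%:Z.
Proof.
have [m] := ubnP #|J|; elim: m K J => // m IHm K J.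
have [-> _ | [j Jj]] := set_0Vmem J.
  rewrite (eq_bigl (pred1 set0)); last by move=> L; rewrite subset0.
  by rewrite big_pred1_eq cards0 mul1r setU0 mixed_rank0.
rewrite (cardsD1 j) Jj /= ltnS => le_J.
have notJj : j \notin J :\ j by rewrite !inE eqxx.
have /eqP := mixed_rankS K notJj; rewrite setD1K // => /eqP rkS.
rewrite (_ : _%:Z = (mixed_rank K (J :\ j))%:Z - (mixed_rank (j |: K) (J :\ j))%:Z);
  last by lia.
rewrite !IHm // [RHS](bigID (fun L : {set _} => j \notin L)) /=; congr (_ + _).
  by apply: eq_bigl => L; rewrite subsetD1.
rewrite -sumrN [RHS](reindex_onto (setU [set j]) (fun L => L :\ j)) /=; last first.
  by move=> L; rewrite negbK => /andP[_ jL]; rewrite setD1K.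
apply: eq_big => [L | L sLJ].
  rewrite subsetD1 subUset sub1set Jj /= !inE eqxx /= andbT; congr (_ && _).
  have [jL | notjL] := boolP (j \in L); last by rewrite setU1K ?eqxx.
  by symmetry; apply/negbTE; apply: contraL jL => /eqP <-; rewrite !inE eqxx.
have notLj : j \notin L by move: sLJ; rewrite subsetD1 => /andP[].
rewrite cardsU1 notLj exprS mulN1r mulNr; congr (- (_ * (\rank (fix_ _))%:Z)).
by rewrite setUCA setUA.
Qed.

End Representation.
End InvariantSpaces.

(** * Twisting by the sign representation *)

Section SignTwist.

Variables (F : fieldType) (gT : finGroupType) (W : {group gT}).
Variables (n : nat) (s : 'I_n -> gT) (eps : mx_representation F W 1).
Variables (d : nat) (V : mx_representation F W d).
Hypotheses (charF : [pchar F] =i pred0) (coxW : coxeter_system W s).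
Hypothesis epsP : is_sign_repr s eps.

(** Summing the twisted action over W_J gives [alt_mx], up to a cast. *)
Lemma rank_rfix_twist (J : {set 'I_n}) :
  \rank (rfix_mx (prod_repr V eps) (parabolic s J)) = \rank (alt_mx s eps V J).
Proof.
rewrite (rfix_mx_sum (prod_repr V eps) charF (parabolic_sub coxW J)) /alt_mx.
rewrite -(rank_castmx (esym (muln1 d), esym (muln1 d))); congr (\rank _).
apply/matrixP=> i j; rewrite summxE castmxE summxE; apply: eq_bigr => x _.
by rewrite /= tprod_scalar castmxE.
Qed.

(** For j in [K], the recursions at (K - j, J) for V and at (J, K - j) for its twist agree by
    induction in all terms but the desired one. *)
Lemma mixed_rank_twist (K J : {set 'I_n}) : [disjoint K & J] ->
  mixed_rank s eps V K J = mixed_rank s eps (prod_repr V eps) J K.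
Proof.
have [m] := ubnP #|K|; elim: m K J => // m IHm K J.
have [-> _ _ | [j Kj]] := set_0Vmem K.
  rewrite mixed_rank0 rank_rfix_twist /mixed_rank.
  have fix1 : (rfix_mx V (parabolic s set0) :=: 1%:M)%MS.
    apply/eqmxP; rewrite submx1; apply/(rfix_parabolicP coxW) => i.
    by rewrite inE.
  by rewrite (eqmxMr _ fix1) mul1mx.
rewrite (cardsD1 j) Kj /= ltnS => le_K; rewrite disjoints_subset => sKJ.
have notJj : j \notin J by rewrite -in_setC (subsetP sKJ).
have sKjJ : K :\ j \subset ~: J by apply: subset_trans sKJ; apply: subsetDl.
have notKj : j \notin K :\ j by rewrite !inE eqxx.
have := mixed_rankS charF coxW epsP V (K :\ j) notJj.
have := mixed_rankS charF coxW epsP (prod_repr V eps) J notKj.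
rewrite setD1K // (IHm (K :\ j) J) ?disjoints_subset //.
rewrite (IHm _ (j |: J)) ?disjoints_subset ?setCU ?subsetI ?sKjJ ?subsetDr //.
by lia.
Qed.

End SignTwist.

(** * Small Kostka numbers as ranks *)

(** Replacing J by its complement in [I] turns the defining sum into [mixed_rank_sum]. *)
Lemma small_kostkaE (F : fieldType) (gT : finGroupType) (W : {group gT})
    (n : nat) (s : 'I_n -> gT) (eps : mx_representation F W 1)
    (d : nat) (V : mx_representation F W d) (I : {set 'I_n}) :
  [pchar F] =i pred0 -> coxeter_system W s -> is_sign_repr s eps ->
  small_kostka s V I = (mixed_rank s eps V (~: I) I)%:Z.
Proof.
move=> charF coxW epsP; rewrite (mixed_rank_sum charF coxW epsP) /small_kostka.
have invol (J : {set 'I_n}) : J \subset I -> I :\: (I :\: J) = J.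
  by move=> sJI; rewrite setDDr setDv set0U; apply/setIidPr.
rewrite (reindex_onto (setD I) (setD I)) /= => [|J /invol //].
apply: eq_big => [J | J].
  rewrite subsetDl /=; apply/eqP/idP => [<- | /invol //]; exact: subsetDl.
rewrite subsetDl /= => /eqP JE; have sJI : J \subset I by rewrite -JE subsetDl.
rewrite kostkaE ?(parabolic_sub coxW) //.
have -> : ~: (I :\: J) = ~: I :|: J.
  by rewrite setDE setCI setCK.
congr (_ * _).
(* The exponent is now negative, which does not change a power of -1. *)
rewrite cardsD (setIidPr sJI) (_ : _ - _ = - #|J|%:Z).
  by rewrite -exprnN -exprVn invrN1.
by rewrite -subzn ?subset_leq_card // addrAC subrr add0r.
Qed.

Theorem theorem3p9p2 (F : fieldType) (gT : finGroupType) (W : {group gT})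
    (n : nat) (s : 'I_n -> gT) (d : nat) (V : mx_representation F W d)
    (I : {set 'I_n}) :
  [pchar F] =i pred0 ->
  coxeter_system W s ->
  mx_irreducible V ->
  (0 <= small_kostka s V I) /\
  (forall eps : mx_representation F W 1, is_sign_repr s eps ->
     small_kostka s V I = small_kostka s (prod_repr V eps) (~: I)).
Proof.
move=> charF coxW _; split=> [|eps epsP].
  (* Some sign representation must be chosen to write the number as a rank. *)
  have [eps epsP] := sign_repr_exists F coxW.
  by rewrite (small_kostkaE V I charF coxW epsP).
rewrite !(small_kostkaE _ _ charF coxW epsP) setCK mixed_rank_twist //.
by rewrite disjoint_sym -setI_eq0 setICr.
Qed.
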